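(* Let $\gamma\ge 1$ and let $T_{\mathrm{S}}$ be the stopping time of the Successive CuSum (S-CuSum) procedure with thresholds $b_0=b_C=\log\gamma$. Then $T_{\mathrm{S}}\in\mathcal{C}_\gamma$, i.e. $\mathbb{E}_\infty[T_{\mathrm{S}}]\ge\gamma$ and $\inf_{\nu\ge1}\mathbb{E}_{\nu,f_C}[T_{\mathrm{S}}]\ge\gamma$.
   Context: Setting: $X_1, X_2, \dots$ is a sequence of independent random variables observed sequentially, with filtration $\mathcal{F}_t=\sigma(X_i: 1\le i\le t)$. The densities $f_0$ (pre-change), $f_C$ (confusing change), $f_B$ (bad change) are known, pairwise different, and are densities on a common measurable space. For a deterministic change-point $\nu\in\{1,2,\dots\}$ and $*\in\{C,B\}$, $\mathbb{P}_{\nu,f_*}$ (expectation $\mathbb{E}_{\nu,f_*}$) is the probability measure under which $X_t\sim f_0$ for $t<\nu$ and $X_t\sim f_*$ for $t\ge\nu$, all independent. $\mathbb{P}_\infty$ (expectation $\mathbb{E}_\infty$) is the measure under which no change occurs, i.e. all $X_t\sim f_0$ i.i.d. False alarm class (over stopping times $T$ with respect to $(\mathcal{F}_t)$): $\mathcal{C}_\gamma := \{T : \mathbb{E}_\infty[T]\ge\gamma,\ \inf_{\nu\ge1}\mathbb{E}_{\nu,f_C}[T]\ge\gamma\}$. S-CuSum procedure with thresholds $b_0,b_C$: write $x^+=\max\{x,0\}$, $W[t]:=\log\frac{f_B(X_t)}{f_0(X_t)}$, $\Lambda[t]:=\log\frac{f_B(X_t)}{f_C(X_t)}$. Define $\mathrm{CuSum}_W[0]=0$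 and, for $t\ge1$, $\mathrm{CuSum}_W[t]=(\mathrm{CuSum}_W[t-1]+W[t])^+$ if $\mathrm{CuSum}_W[t-1]<b_0$, and $\mathrm{CuSum}_W[t]=\mathrm{CuSum}_W[t-1]$ otherwise. Define $\mathrm{CuSum}^{\mathrm{S}}_\Lambda[t]=0$ if $t=0$ or $\mathrm{CuSum}_W[t]<b_0$, and $\mathrm{CuSum}^{\mathrm{S}}_\Lambda[t]=(\mathrm{CuSum}^{\mathrm{S}}_\Lambda[t-1]+\Lambda[t])^+$ otherwise. The stopping time is $T_{\mathrm{S}}:=\inf\{t\ge1:\ \mathrm{CuSum}_W[t]\ge b_0,\ \mathrm{CuSum}^{\mathrm{S}}_\Lambda[t]\ge b_C\}$. *)

(* Defs.v *)
From HB Require Import structures.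
From mathcomp Require Import all_boot all_order all_algebra.
From mathcomp Require Import all_classical all_reals all_analysis.

Set Implicit Arguments.
Unset Strict Implicit.
Unset Printing Implicit Defensive.

Import Order.TTheory GRing.Theory Num.Theory.
Import numFieldNormedType.Exports.

Local Open Scope classical_set_scope.
Local Open Scope ring_scope.

(* Observations are indexed by t = 1, 2, ...: a process is a sequence
   X : nat -> {mfun Omega >-> E} whose entry X 0 is never referred to. *)

Section Model.
Context {R : realType} {d dE : measure_display}.
Context {Omega : measurableType d} {E : measurableType dE}.
Implicit Types (mu : {measure set E -> \bar R}) (P : probability Omega R).
Implicit Types (X : nat -> {mfun Omega >-> E}).

Definition is_density mu (f : E -> R) : Prop :=
  [/\ measurable_fun setT f, forall x, 0 <= f x
    & (\int[mu]_x (f x)%:E = 1)%E].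

Definition mutually_independent P X : Prop :=
  forall (s : seq nat) (A : nat -> set E),
    uniq s -> all (leq 1) s -> (forall i, measurable (A i)) ->
    P (\bigcap_(i in [set` s]) (X i @^-1` A i)) =
    (\prod_(i <- s) P (X i @^-1` A i))%E.

(* Under P the X_t, t >= 1, are independent and X_t has density f t. *)
Definition independent_with_densities mu X P (f : nat -> E -> R) : Prop :=
  mutually_independent P X /\
  forall t, (1 <= t)%N -> forall A, measurable A ->
    distribution P (X t) A = (\int[mu]_(x in A) (f t x)%:E)%E.

Definition no_change_law mu X (f0 : E -> R) P : Prop :=
  independent_with_densities mu X P (fun=> f0).

Definition change_point_law mu X (f0 f1 : E -> R) (nu : nat) P : Prop :=
  independent_with_densities mu X P (fun t => if (t < nu)%N then f0 else f1).

Definition natural_filtration X (t : nat) : set (set Omega) :=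
  <<s \bigcup_(i in [set i | (1 <= i <= t)%N])
        preimage_set_system setT (X i) measurable >>.

(* A stopping time has values in {0, 1, 2, ...} together with +oo. *)
Definition stopping_time (F : nat -> set (set Omega)) (T : Omega -> \bar R) :
    Prop :=
  (forall w, T w = +oo%E \/ exists n : nat, T w = n%:R%:E) /\
  (forall t : nat, F t [set w | (T w <= t%:R%:E)%E]).

Definition false_alarm_class X (Pinf : probability Omega R)
    (PC : nat -> probability Omega R) (gamma : R) : set (Omega -> \bar R) :=
  [set T | [/\ stopping_time (natural_filtration X) T,
     (gamma%:E <= \int[Pinf]_w T w)%E
   & (gamma%:E <=
      ereal_inf [set \int[PC nu]_w T w | nu in [set nu | 1 <= nu]%N])%E]].

End Model.

Section SCuSum.
Context {R : realType} {E : Type}.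
Local Open Scope ereal_scope.
Implicit Types (x : nat -> E).

(* Extended-real valued, so that a density may vanish: the value is -oo when
   f y = 0 (also when f y = g y = 0) and +oo when g y = 0 < f y.  The real
   logarithm would not do, as the library sets ln 0 = 0. *)
Definition log_ratio (f g : E -> R) (y : E) : \bar R :=
  lne ((f y)%:E / (g y)%:E).

Fixpoint cusumW (f0 fB : E -> R) (b0 : R) x (t : nat) : \bar R :=
  if t is s.+1 then
    let c := cusumW f0 fB b0 x s in
    if c < b0%:E then maxe (c + log_ratio fB f0 (x t)) 0 else c
  else 0.

Fixpoint cusumSL (f0 fC fB : E -> R) (b0 : R) x (t : nat) : \bar R :=
  if t is s.+1 then
    if cusumW f0 fB b0 x t < b0%:E then 0
    else maxe (cusumSL f0 fC fB b0 x s + log_ratio fB fC (x t)) 0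
  else 0.

(* +oo when the thresholds are never crossed, ereal_inf set0 being +oo. *)
Definition scusum_time (f0 fC fB : E -> R) (b0 bC : R) x : \bar R :=
  ereal_inf [set (t%:R)%:E | t in
    [set t : nat | [/\ (1 <= t)%N, b0%:E <= cusumW f0 fB b0 x t
      & bC%:E <= cusumSL f0 fC fB b0 x t]]].

End SCuSum.

(* Main.v *)
Require Import Defs.
From HB Require Import structures.
From mathcomp Require Import all_boot all_order all_algebra.
From mathcomp Require Import all_classical all_reals all_analysis.
From mathcomp Require Import measurable_realfun lra.

Set Implicit Arguments.
Unset Strict Implicit.

Import Order.TTheory GRing.Theory Num.Theory.
Import numFieldNormedType.Exports.

Local Open Scope classical_set_scope.
Local Open Scope ring_scope.

(* Let f_t be the true density at time t (f0 before the change, fC after it).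
   The Shiryaev-Roberts process V_0 = 0, V_t = (1 + V_{t-1}) fB(X_t)/f_t(X_t)
   satisfies E[V_t | F_{t-1}] <= 1 + V_{t-1}, because fB/f_t has mean at most 1
   under f_t.  As long as CuSum_W has not crossed before the change, V dominates
   exp CuSum_W before the change and the exponential of the successive CuSum
   after it.  Hence V >= gamma at the time tau when either CuSum_W crosses before
   the change or the procedure stops, and tau <= T_S.  Optional stopping gives
   gamma P(tau <= n) <= E[min(tau, n)], and n -> oo yields gamma <= E[T_S].
   Absence of a change is the case where every time is before the change. *)

(** * Measurability of the extended logarithm and inverse *)

Lemma measurable_lne (R : realType) : measurable_fun setT (@lne R).
Proof.
apply: (measurability _ (ErealGenOInfty.measurableE R)) => _ [_ [c ->] <-].
rewrite setTI (_ : _ @^-1` _ = [set` `](expR c)%:E, +oo%E]]).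
  exact: emeasurable_itv.
apply/seteqP; split => x /=; rewrite !in_itv/= !andbT ?leey ?andbT.
  case: x => [r| |]//=; last by rewrite !ltry.
  case: ifPn => //; rewrite -ltNge !lte_fin => r0.
  by rewrite -ltr_expR lnK ?posrE.
case: x => [r| |]//=; last by rewrite !ltry.
rewrite !lte_fin => cr.
have r0 : 0 < r by apply: lt_trans cr; exact: expR_gt0.
by rewrite leNgt r0/= lte_fin -ltr_expR lnK.
Qed.

Lemma measurable_inve_EFin (R : realType) d (T : measurableType d) (f : T -> R) :
  measurable_fun setT f -> (forall x, 0 <= f x) ->
  measurable_fun setT (fun x => (f x)%:E^-1)%E.
Proof.
(* The extended inverse of 0 is [+oo], hence a case split; elsewhere it is the power -1, whose
   measurability is known. *)
move=> mf f0; under eq_fun do rewrite inver -powR_inv1//.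
apply: measurable_fun_ifT => //; first exact: measurable_fun_eqr.
by apply/measurable_EFinP; exact: (measurableT_comp (measurable_powR _)).
Qed.

(** * Integration against a measure given by a density *)

Section density.
Context (R : realType) d (T : measurableType d).
Variables (mu nu : {measure set T -> \bar R}) (f : T -> R).
Hypotheses (mf : measurable_fun setT f) (f0 : forall x, 0 <= f x).
Hypothesis nuE : forall A, measurable A -> (nu A = \int[mu]_(x in A) (f x)%:E)%E.

Import HBNNSimple.

Let nnsfun_integral_density (g : {nnsfun T >-> R}) :
  (\int[mu]_x ((g x)%:E * (f x)%:E) = sintegral nu g)%E.
Proof.
rewrite sintegralE.
under eq_integral => x _.
  rewrite (fimfunE g) -fsumEFin// ge0_mule_fsuml; last first.
    by move=> y; exact: nnfun_muleindic_ge0.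
  over.
rewrite ge0_integral_fsum//; last 2 first.
  - move=> y; apply: emeasurable_funM; last exact/measurable_EFinP.
    by apply/measurable_EFinP; exact: measurable_funM.
  - move=> y x _; apply: mule_ge0; last by rewrite lee_fin.
    exact: nnfun_muleindic_ge0.
apply: eq_fsbigr => y yg.
under eq_integral do rewrite EFinM -muleA.
have y0 : 0 <= y by move: yg; rewrite inE => -[x _ <-].
rewrite ge0_integralZl//; last 2 first.
  - apply: emeasurable_funM; last exact/measurable_EFinP.
    exact/measurable_EFinP.
  - by move=> x _; rewrite mule_ge0 ?lee_fin.
rewrite nuE// [in RHS]integral_mkcond; congr (_ * _)%E.
by apply: eq_integral => x _; rewrite epatch_indic muleC.
Qed.

(** The case of simple functions follows from [nuE] by linearity; monotone convergence along the
    increasing approximation [g] carries it over to [h]. *)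
Lemma ge0_integral_density (h : T -> \bar R) :
    measurable_fun setT h -> (forall x, 0 <= h x)%E ->
  (\int[nu]_x h x = \int[mu]_x (h x * (f x)%:E))%E.
Proof.
move=> mh h0; pose g := nnsfun_approx measurableT mh.
have g_nd x : {homo (g^~ x : nat -> R) : m n / (m <= n)%N >-> m <= n}.
  by move=> m n mn; exact/lefP/nd_nnsfun_approx.
have g_cvg x : EFin \o g^~ x @ \oo --> h x by exact: cvg_nnsfun_approx.
rewrite (nd_ge0_integral_lim _ h0 g_nd g_cvg).
rewrite (_ : _ \o _ = fun n => \int[mu]_x ((g n x)%:E * (f x)%:E))%E; last first.
  by apply/funext => n /=; rewrite nnsfun_integral_density.
rewrite -monotone_convergence//; last 3 first.
- move=> n; apply: emeasurable_funM; exact/measurable_EFinP.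
- by move=> n x _; rewrite mule_ge0 ?lee_fin.
- by move=> x _ m n mn; rewrite lee_wpmul2r ?lee_fin ?f0 ?g_nd.
apply: eq_integral => x _; apply/cvg_lim => //.
by apply: cvgeZr => //; exact: g_cvg.
Qed.

End density.

(** * Likelihood ratios *)

Section ratio.
Context (R : realType) d (T : measurableType d) (mu : {measure set T -> \bar R}).
Variables (f g : T -> R).
Hypotheses (df : is_density mu f) (dg : is_density mu g).

Lemma ratio_ge0 x : (0 <= (f x)%:E / (g x)%:E)%E.
Proof.
by case: df dg => _ f0 _ [_ g0 _]; rewrite mule_ge0 ?inve_ge0 ?lee_fin.
Qed.

Lemma measurable_ratio : measurable_fun setT (fun x => (f x)%:E / (g x)%:E)%E.
Proof.
case: df dg => mf f0 _ [mg g0 _].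
apply: emeasurable_funM; first exact/measurable_EFinP.
exact: measurable_inve_EFin.
Qed.

Lemma measurable_log_ratio : measurable_fun setT (log_ratio f g).
Proof. exact: (measurableT_comp (@measurable_lne R) measurable_ratio). Qed.

(** Under [mu] the integrand becomes [f / g * g], which is [f] where [g] is nonzero and 0 elsewhere.
    The mass of [f] on the zeros of [g] is lost, so only an inequality holds. *)
Lemma integral_ratio_le1 (nu : {measure set T -> \bar R}) :
  (forall A, measurable A -> (nu A = \int[mu]_(x in A) (g x)%:E)%E) ->
  (\int[nu]_x ((f x)%:E / (g x)%:E) <= 1)%E.
Proof.
case: (df) (dg) => mf f0 f1 [mg g0 _] nuE.
rewrite (ge0_integral_density mg g0 nuE measurable_ratio ratio_ge0) -f1.
apply: ge0_le_integral => //.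
- by move=> x _; rewrite mule_ge0 ?ratio_ge0 ?lee_fin.
- by apply: emeasurable_funM; [exact: measurable_ratio|exact/measurable_EFinP].
- exact/measurable_EFinP.
move=> x _; have [gx0|gx0] := eqVneq (g x) 0; first by rewrite gx0 mule0 lee_fin.
by rewrite -muleA mulVe ?mule1 ?eqe.
Qed.

End ratio.

(** * Independence of the next observation from the past *)

Lemma ge0_integral_indepM (R : realType) d d1 d2 (T : measurableType d)
    (T1 : measurableType d1) (T2 : measurableType d2) (P : probability T R)
    (Y : {mfun T >-> T1}) (Z : {mfun T >-> T2})
    (g : T1 -> \bar R) (h : T2 -> \bar R) :
  (forall A B, measurable A -> measurable B ->
    P (Y @^-1` A `&` Z @^-1` B) = P (Y @^-1` A) * P (Z @^-1` B))%E ->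
  measurable_fun setT g -> (forall x, 0 <= g x)%E ->
  measurable_fun setT h -> (forall x, 0 <= h x)%E ->
  (\int[P]_w (g (Y w) * h (Z w)) =
   \int[P]_w g (Y w) * \int[distribution P Z]_z h z)%E.
Proof.
move=> ind mg g0 mh h0.
have mYZ : measurable_fun setT (fun w => (Y w, Z w)) by exact: measurable_fun_pair.
pose gh (p : T1 * T2) := (g p.1 * h p.2)%E.
have mgh : measurable_fun setT gh.
  by apply: emeasurable_funM;
    [exact: (measurableT_comp mg)|exact: (measurableT_comp mh)].
have gh0 p : (0 <= gh p)%E by exact: mule_ge0.
transitivity (\int[pushforward P (fun w => (Y w, Z w))]_p gh p)%E.
  by rewrite ge0_integral_pushforward.
(* By independence the joint law agrees with the product law on rectangles, hence everywhere;
   Tonelli then separates the two factors. *)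
rewrite (eq_measure_integral (distribution P Y \x distribution P Z)%E); last first.
  by move=> A mA _; apply/esym; exact: product_measure_unique.
rewrite fubini_tonelli1//.
transitivity (\int[distribution P Y]_y (g y * \int[distribution P Z]_z h z))%E.
  by apply: eq_integral => y _; rewrite /fubini_F /gh/= ge0_integralZl.
rewrite ge0_integralZr//; last exact: integral_ge0.
by rewrite [in LHS]ge0_integral_pushforward.
Qed.

Section history.
Context (R : realType) d dE (Omega : measurableType d) (E : measurableType dE).
Variables (P : probability Omega R) (X : nat -> {mfun Omega >-> E}).

(** Unlike the generators in [natural_filtration], these sets are stable under intersection, as
    uniqueness of measures requires. *)
Definition cylinders (t : nat) : set (set Omega) :=
  [set \bigcap_(i in [set` iota 1 t]) (X i @^-1` A i) |
    A in [set A : nat -> set E | forall i, measurable (A i)]].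

Lemma natural_filtration_cylinders t :
  natural_filtration X t `<=` <<s cylinders t >>.
Proof.
apply: smallest_sub; first exact: smallest_sigma_algebra.
move=> _ [i /= it [B mB <-]]; apply: sub_sigma_algebra.
exists (fun j => if j == i then B else setT).
  by move=> j; case: ifP.
rewrite setTI; apply/seteqP; split => w /=.
  by move=> /(_ i); rewrite /= eqxx mem_iota add1n ltnS; exact.
by move=> Bw j _; case: eqP => // ->.
Qed.

Lemma natural_filtration_measurable t : natural_filtration X t `<=` measurable.
Proof.
apply: smallest_sub; first exact: sigma_algebra_measurable.
by move=> _ [i _ [B mB <-]]; exact: measurable_funPT.
Qed.

(** For fixed [B], both sides are finite measures in [A]; they agree on cylinders by mutual
    independence, hence on the generated sigma-algebra. *)
Lemma natural_filtration_indep t (A : set Omega) (B : set E) :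
  mutually_independent P X -> natural_filtration X t A -> measurable B ->
  (P (A `&` X t.+1 @^-1` B) = P A * P (X t.+1 @^-1` B))%E.
Proof.
move=> ind FA mB.
have mXB : measurable (X t.+1 @^-1` B).
  by rewrite -[_ @^-1` _]setTI; exact: measurable_funPT.
have p0 : 0 <= fine (P (X t.+1 @^-1` B)) by exact: fine_ge0.
rewrite muleC -[P (X _ @^-1` B)]fineK ?fin_num_measure//.
apply: (@g_sigma_algebra_measure_unique _ _ _ (cylinders t) _ (fun=> setT) _ _
  (mrestr P mXB) (mscale (NngNum p0) P)) => //.
- move=> _ [C mC <-]; apply: fin_bigcap_measurable => // i _.
  by rewrite -[_ @^-1` _]setTI; exact: measurable_funPT.
- move=> _; exists (fun=> setT) => //.
  by rewrite -subTset => w _ i _.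
- by rewrite bigcup_const.
- move=> _ _ [A1 mA1 <-] [A2 mA2 <-]; exists (fun i => A1 i `&` A2 i).
    by move=> i; exact: measurableI.
  by rewrite -bigcapI.
- move=> _ [C mC <-]; set D := \bigcap_(i in _) _.
  change (P (D `&` X t.+1 @^-1` B) = (fine (P (X t.+1 @^-1` B)))%:E * P D)%E.
  rewrite fineK ?fin_num_measure//.
  (* Adjoining [B] at index [t.+1] turns the intersection of [D] with the new event into one
     cylinder over [t.+1 :: iota 1 t]. *)
  pose C' i := if i == t.+1 then B else C i.
  have mC' i : measurable (C' i) by rewrite /C'; case: ifP.
  have C'C i : i \in iota 1 t -> C' i = C i.
    by rewrite mem_iota add1n /C' ltnS; case: eqP => // ->; rewrite ltnn andbF.
  have /= := ind (t.+1 :: iota 1 t) C'.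
  rewrite mem_iota iota_uniq add1n ltnn andbF => /(_ isT).
  have it1 : all (leq 1) (iota 1 t).
    by apply/allP => i; rewrite mem_iota => /andP[].
  move=> /(_ it1 mC'); rewrite big_cons -(ind _ _ (iota_uniq 1 t) it1 mC').
  have -> : \bigcap_(i in [set` iota 1 t]) (X i @^-1` C' i) = D.
    by apply: eq_bigcapr => i /= /C'C ->.
  rewrite [C' t.+1]/C' eqxx => <-; congr (P _).
  apply/seteqP; split => [w [Dw Bw] i /=|w Cw].
    rewrite inE => /predU1P[->|it]; first by rewrite /C' eqxx.
    by rewrite C'C//; exact: Dw.
  split=> [i /= it|]; last first.
    by have := Cw t.+1; rewrite /= /C' eqxx; apply; exact: mem_head.
  by rewrite -C'C//; apply: Cw; rewrite /= inE it orbT.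
- move=> _; change (P (setT `&` X t.+1 @^-1` B) < +oo)%E.
  by rewrite setTI ltey_eq fin_num_measure.
- exact: natural_filtration_cylinders.
Qed.

End history.

(** * Pathwise domination by the Shiryaev-Roberts process *)

Lemma lneM_ge0 (R : realType) (u v : \bar R) :
  (0 <= u -> 0 <= v -> lne (u * v) = lne u + lne v)%E.
Proof.
(* Infinite values need no exception: 0 * +oo = 0 matches -oo + +oo = -oo. *)
move=> u0 v0; apply: expeR_inj; rewrite expeRD !lneK ?in_itv/= ?leey ?andbT//.
exact: mule_ge0.
Qed.

(** Since max(1, v) <= 1 + v, multiplying by [l] preserves the domination; the outer maximum with 1
    absorbs the reflection at 0. Both CuSum recursions use this step. *)
Lemma cusum_step_le (R : realType) (c l v : \bar R) :
  (0 <= v -> 0 <= l -> c <= lne (maxe 1 v) ->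
   maxe (c + lne l) 0 <= lne (maxe 1 ((1 + v) * l)))%E.
Proof.
move=> v0 l0 cv; rewrite ge_max; apply/andP; split;
  last by rewrite lne_ge0 le_max lexx.
apply: (le_trans (leeD cv (lexx _))).
rewrite -lneM_ge0 ?le_max ?lee01//.
rewrite lee_lne ?in_itv/= ?leey ?andbT ?mule_ge0 ?le_max ?lee01//.
rewrite lee_wpmul2r ?orbT// ge_max leeDl//=.
by rewrite leeDr ?lee01.
Qed.

Section pathwise.
Context (R : realType) (E : Type).
(* [pre] is the set of pre-change times: [xpredT] when there is no change. *)
Variables (f0 fC fB : E -> R) (b : R) (pre : pred nat).
Local Open Scope ereal_scope.
Implicit Types (x : nat -> E) (t : nat).

Definition density_at t : E -> R := if pre t then f0 else fC.

Fixpoint shiryaev_roberts x t : \bar R :=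
  if t is s.+1 then
    (1 + shiryaev_roberts x s) * ((fB (x t))%:E / (density_at t (x t))%:E)
  else 0.

(* The stopping time tau: unlike T_S, it also stops when CuSum_W crosses before
   the change, since V does not control the successive CuSum started then. *)
Definition stops x t : bool :=
  (b%:E <= cusumW f0 fB b x t) && (pre t || (b%:E <= cusumSL f0 fC fB b x t)).

(** The event tau > t. Time 0 is never tested, so tau >= 1. *)
Fixpoint alive x t : bool :=
  if t is s.+1 then alive x s && ~~ stops x t else true.

Lemma alive_le x s t : (s <= t)%N -> alive x t -> alive x s.
Proof.
elim: t => [|t IH]; first by rewrite leqn0 => /eqP ->.
by rewrite leq_eqVlt ltnS => /predU1P[->//|/IH{}IH] /= /andP[/IH].
Qed.

(** The sum is min(tau, n). At any [m] where both statistics cross, [stops x m] holds whatever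
    [pre m] is, so tau <= m. *)
Lemma sum_alive_le_scusum_time x n :
  \sum_(t < n) (alive x t)%:R%:E <= scusum_time f0 fC fB b b x.
Proof.
apply: le_ereal_inf_tmp => _ [m [m1 Wm SLm] <-].
rewrite sumEFin lee_fin -natr_sum ler_nat.
have alive_lt t : (alive x t <= (t < m))%N.
  rewrite ltnNge; case: (leqP m t) => [mt|]; last by case: (alive x t).
  rewrite (_ : alive x t = false)//; apply/negP => /(alive_le mt).
  by case: m m1 Wm SLm {mt} => //= m _ Wm SLm; rewrite /stops Wm SLm orbT andbF.
apply: (@leq_trans (\sum_(t < n) (t < m))%N); first exact: leq_sum.
rewrite (_ : \sum_(t < n) _ = minn n m)%N ?geq_minr//.
elim: n => [|n IH]; first by rewrite big_ord0 min0n.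
rewrite big_ord_recr/= IH; case: (ltnP n m) => nm.
  by rewrite (minn_idPl nm) addn1.
by rewrite (minn_idPr (leqW nm)) addn0.
Qed.

Hypotheses (b_gt0 : (0 < b)%R) (pre_down : forall t, pre t.+1 -> pre t).
Hypotheses (f0_ge0 : forall y, (0 <= f0 y)%R) (fC_ge0 : forall y, (0 <= fC y)%R).
Hypothesis fB_ge0 : forall y, (0 <= fB y)%R.

Lemma ratio_at_ge0 t y : 0 <= (fB y)%:E / (density_at t y)%:E.
Proof.
by rewrite mule_ge0 ?inve_ge0 ?lee_fin ?fB_ge0// /density_at; case: ifP.
Qed.

Lemma shiryaev_roberts_ge0 x t : 0 <= shiryaev_roberts x t.
Proof.
by elim: t => //= t IH; rewrite mule_ge0 ?ratio_at_ge0// adde_ge0.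
Qed.

(** Since [b > 0], [expR b] exceeds 1, so the maximum can reach it only through [v]. *)
Lemma le_lne_max (v : \bar R) : b%:E <= lne (maxe 1 v) -> (expR b)%:E <= v.
Proof.
rewrite -lee_expeR lneK ?in_itv/= ?leey ?andbT ?le_max ?lee01//.
by rewrite lee_fin [(_ <= 1)%R]leNgt expR_gt1 b_gt0.
Qed.

(** Hence, before the change and before tau, CuSum_W is not frozen and the successive CuSum is still
    0. *)
Lemma cusumW_lt x t : alive x t -> pre t -> cusumW f0 fB b x t < b%:E.
Proof.
case: t => [|t] al pt; first by rewrite lte_fin.
by move: al => /= /andP[_]; rewrite /stops pt andbT -ltNge.
Qed.

(** Survival is required only up to [t.-1], so that the bound also covers the time tau itself. *)
Lemma cusumW_le x t : alive x t.-1 -> pre t ->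
  cusumW f0 fB b x t <= lne (maxe 1 (shiryaev_roberts x t)).
Proof.
elim: t => [|t IH] al pt; first by rewrite lne_ge0 le_max lexx.
have := ratio_at_ge0 t.+1 (x t.+1).
rewrite [cusumW _ _ _ _ _]/= (cusumW_lt al (pre_down pt)).
rewrite [shiryaev_roberts _ _]/= /density_at pt => r0.
apply: cusum_step_le => //; first exact: shiryaev_roberts_ge0.
by apply: IH; [exact: alive_le (leq_pred t) al|exact: pre_down].
Qed.

(** After the change the factor of the Shiryaev-Roberts recursion is [fB / fC], whose logarithm is
    the increment of the successive CuSum. Survival at [t.+1] is not assumed, so the step also
    applies at tau. *)
Lemma cusumSL_step_le x t : ~~ pre t.+1 ->
  cusumSL f0 fC fB b x t <= lne (maxe 1 (shiryaev_roberts x t)) ->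
  cusumSL f0 fC fB b x t.+1 <= lne (maxe 1 (shiryaev_roberts x t.+1)).
Proof.
move=> npt IH; rewrite [cusumSL _ _ _ _ _ _]/=.
case: ifP => _; first by rewrite lne_ge0 le_max lexx.
have := ratio_at_ge0 t.+1 (x t.+1).
rewrite [shiryaev_roberts _ _.+1]/= /density_at (negbTE npt) => r0.
by apply: cusum_step_le => //; exact: shiryaev_roberts_ge0.
Qed.

Lemma cusumSL_le x t : alive x t ->
  cusumSL f0 fC fB b x t <= lne (maxe 1 (shiryaev_roberts x t)).
Proof.
elim: t => [_|t IH al]; first by rewrite lne_ge0 le_max lexx.
have [pt|npt] := boolP (pre t.+1).
  have /= -> := cusumW_lt al pt.
  by rewrite lne_ge0 le_max lexx.
by apply: cusumSL_step_le => //; apply: IH; exact: alive_le al.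
Qed.

Lemma stops_shiryaev_roberts_ge x t : alive x t -> stops x t.+1 ->
  (expR b)%:E <= shiryaev_roberts x t.+1.
Proof.
move=> al /andP[bW st]; apply: le_lne_max.
have [pt|npt] := boolP (pre t.+1); first exact: le_trans (@cusumW_le x t.+1 al pt).
move: st; rewrite (negbTE npt) => /le_trans; apply.
by apply: cusumSL_step_le => //; exact: cusumSL_le.
Qed.

End pathwise.

(** * Measurability of the statistics *)

Section measurability.
Context (R : realType) dE (E : measurableType dE) (mu : {measure set E -> \bar R}).
Variables (f0 fC fB : E -> R) (b : R) (pre : pred nat).
Hypotheses (df0 : is_density mu f0) (dfC : is_density mu fC).
Hypothesis dfB : is_density mu fB.
Context d (T : measurableType d) (X : nat -> T -> E) (n : nat).
Hypothesis mX : forall i, (1 <= i <= n)%N -> measurable_fun setT (X i).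
Local Open Scope ereal_scope.

(** The sigma-algebra of [T] is arbitrary and only the first [n] observations are assumed
    measurable, so the results serve both for the full sigma-algebra and for the natural filtration
    at a fixed time. *)
Lemma measurable_cusumW t : (t <= n)%N ->
  measurable_fun setT (fun w => cusumW f0 fB b (X^~ w) t).
Proof.
elim: t => [|t IH] tn /=; first exact: measurable_cst.
have mW := IH (ltnW tn).
apply: measurable_fun_ifT => //; first exact: measurable_fun_lte.
apply: measurable_maxe => //; apply: emeasurable_funD => //.
exact: (measurableT_comp (measurable_log_ratio dfB df0) (mX _)).
Qed.

Lemma measurable_cusumSL t : (t <= n)%N ->
  measurable_fun setT (fun w => cusumSL f0 fC fB b (X^~ w) t).
Proof.
elim: t => [|t IH] tn /=; first exact: measurable_cst.
apply: measurable_fun_ifT => //.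
  by apply: measurable_fun_lte => //; exact: (measurable_cusumW tn).
apply: measurable_maxe => //; apply: emeasurable_funD; first exact/IH/ltnW.
exact: (measurableT_comp (measurable_log_ratio dfB dfC) (mX _)).
Qed.

Lemma is_density_at t : is_density mu (density_at f0 fC pre t).
Proof. by rewrite /density_at; case: ifP. Qed.

Lemma measurable_shiryaev_roberts t : (t <= n)%N ->
  measurable_fun setT (fun w => shiryaev_roberts f0 fC fB pre (X^~ w) t).
Proof.
elim: t => [|t IH] tn /=; first exact: measurable_cst.
apply: emeasurable_funM.
  by apply: emeasurable_funD => //; exact/IH/ltnW.
exact: (measurableT_comp (measurable_ratio dfB (is_density_at t.+1)) (mX _)).
Qed.

Lemma measurable_crossing t : (t <= n)%N ->
  measurable_fun setT (fun w => (b%:E <= cusumW f0 fB b (X^~ w) t) &&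
    (b%:E <= cusumSL f0 fC fB b (X^~ w) t)).
Proof.
move=> tn; apply: measurable_and; apply: measurable_fun_lee => //.
  exact: (measurable_cusumW tn).
exact: (measurable_cusumSL tn).
Qed.

Lemma measurable_alive t : (t <= n)%N ->
  measurable_fun setT (fun w => alive f0 fC fB b pre (X^~ w) t).
Proof.
elim: t => [|t IH] tn /=; first exact: measurable_cst.
apply: measurable_and; first exact/IH/ltnW.
apply: measurable_neg; apply: measurable_and.
  by apply: measurable_fun_lee => //; exact: (measurable_cusumW tn).
apply: measurable_or => //.
by apply: measurable_fun_lee => //; exact: (measurable_cusumSL tn).
Qed.

End measurability.

(** * The procedure as a stopping time *)

Lemma scusum_time_values (R : realType) (E : Type) (f0 fC fB : E -> R) (b : R)
    (x : nat -> E) :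
  let T := scusum_time f0 fC fB b b x in
  (T = +oo \/ exists n : nat, [/\ T = n%:R%:E, (1 <= n)%N,
    b%:E <= cusumW f0 fB b x n & b%:E <= cusumSL f0 fC fB b x n])%E.
Proof.
rewrite /scusum_time/=; set A := (X in ereal_inf (_ @` X)).
have [[n An]|nA] := pselect (exists n, A n); last first.
  left; rewrite (_ : _ @` _ = set0) ?ereal_inf0//.
  by apply/seteqP; split => // t [n An _]; apply: nA; exists n.
right.
have exA : exists n, `[<A n>] by exists n; exact/asboolP.
(* The infimum is attained at the least crossing time. *)
have [m /asboolP Am mmin] := ex_minnP exA.
exists m; split; try by case: Am.
apply/eqP; rewrite eq_le; apply/andP; split.
  by apply: ereal_inf_lbound; exists m.
apply: le_ereal_inf_tmp => _ [k Ak <-].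
by rewrite lee_fin ler_nat; apply: mmin; exact/asboolP.
Qed.

Section stopping.
Context (R : realType) d dE (Omega : measurableType d) (E : measurableType dE).
Variables (mu : {measure set E -> \bar R}) (f0 fC fB : E -> R) (b : R).
Hypotheses (df0 : is_density mu f0) (dfC : is_density mu fC).
Hypothesis dfB : is_density mu fB.
Variable X : nat -> {mfun Omega >-> E}.

Lemma natural_filtration_measurable_fun t i : (1 <= i <= t)%N ->
  @measurable_fun _ _ (g_sigma_algebraType (\bigcup_(i in [set i | (1 <= i <= t)%N])
        preimage_set_system setT (X i) measurable)) E setT (X i).
Proof.
move=> it _ B mB; rewrite setTI; apply: sub_sigma_algebra.
by exists i => //; exists B; rewrite ?setTI.
Qed.

(** Because the infimum is attained, stopping by time [t] is a finite union of crossing events at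
    times between 1 and [t]. *)
Lemma scusum_time_stopping_time : stopping_time (natural_filtration X)
  (fun w => scusum_time f0 fC fB b b (X^~ w)).
Proof.
split=> [w|t].
  have [->|[n [-> _ _ _]]] := scusum_time_values f0 fC fB b (X^~ w); first by left.
  by right; exists n.
pose F n := [set w | (b%:E <= cusumW f0 fB b (X^~ w) n)%E &&
    (b%:E <= cusumSL f0 fC fB b (X^~ w) n)%E].
rewrite (_ : [set w | _] = \bigcup_(n in [set n | (1 <= n <= t)%N]) F n).
  apply: (@fin_bigcup_measurable _ (g_sigma_algebraType _)).
    by apply: (sub_finite_set _ (finite_II t.+1)) => n /= /andP[_]; rewrite ltnS.
  move=> n /= /andP[_ nt].
  have := measurable_crossing b df0 dfC dfB (@natural_filtration_measurable_fun t) nt.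
  by move=> /(_ measurableT [set true] I); rewrite setTI.
apply/seteqP; split => [w /=|w [n /= /andP[n1 nt] /andP[Wn SLn]]].
  have [->|[n [-> n1 Wn SLn]]] := scusum_time_values f0 fC fB b (X^~ w).
    by rewrite leye_eq.
  by rewrite lee_fin ler_nat => nt; exists n; apply/andP.
apply: (@le_trans _ _ n%:R%:E); last by rewrite lee_fin ler_nat.
by apply: ereal_inf_lbound; exists n.
Qed.

(** As finite values are natural numbers, S > c fails exactly when S <= n for some natural n <=
    c. *)
Lemma measurable_stopping_time (S : Omega -> \bar R) :
  stopping_time (natural_filtration X) S -> measurable_fun setT S.
Proof.
move=> [Sval Sle]; apply: (measurability _ (ErealGenOInfty.measurableE R)).
move=> _ [_ [c ->] <-]; rewrite setTI.
rewrite (_ : _ @^-1` _ = ~` \bigcup_(n in [set n | n%:R <= c])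
  [set w | (S w <= n%:R%:E)%E]).
  apply: measurableC; apply: bigcup_measurable => n _.
  exact: natural_filtration_measurable (Sle n).
apply/seteqP; split => w /=; rewrite in_itv/= andbT ltNge.
  by move=> /negP Sc [n nc Sn]; apply: Sc; rewrite (le_trans Sn)// lee_fin.
move=> nS; apply/negP => Sc; apply: nS.
have [Sy|[n Sn]] := Sval w; first by rewrite Sy in Sc.
by exists n => /=; [rewrite -lee_fin -Sn|rewrite Sn].
Qed.

End stopping.

(** * Optional stopping in expectation *)

Section expectation.
Context (R : realType) d dE (Omega : measurableType d) (E : measurableType dE).
Variables (mu : {measure set E -> \bar R}) (f0 fC fB : E -> R) (b : R).
Variable pre : pred nat.
Hypotheses (df0 : is_density mu f0) (dfC : is_density mu fC).
Hypothesis dfB : is_density mu fB.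
Variables (X : nat -> {mfun Omega >-> E}) (P : probability Omega R).
Hypothesis law : independent_with_densities mu X P (density_at f0 fC pre).
Hypotheses (b_gt0 : 0 < b) (pre_down : forall t, pre t.+1 -> pre t).
Local Open Scope ereal_scope.

Let V t w := shiryaev_roberts f0 fC fB pre (X^~ w) t.
Let al t w := alive f0 fC fB b pre (X^~ w) t.
Let a t w : \bar R := (al t w)%:R%:E.

Let mX t i : (1 <= i <= t)%N -> measurable_fun setT (X i).
Proof. by move=> _; exact: measurable_funPT. Qed.

Let V_ge0 t w : 0 <= V t w.
Proof.
by case: df0 dfC dfB => _ ? _ [_ ? _] [_ ? _]; exact: shiryaev_roberts_ge0.
Qed.

Let a_ge0 t w : 0 <= a t w. Proof. by rewrite lee_fin. Qed.

Let measurable_indicator d' (T : measurableType d') (f : T -> bool) :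
  measurable_fun setT f -> measurable_fun setT (fun w => (f w)%:R%:E : \bar R).
Proof.
move=> mf; rewrite (_ : (fun w => _) = fun w => if f w then 1 else 0).
  exact: measurable_fun_ifT.
by apply/funext => w; case: (f w).
Qed.

Let mV t : measurable_fun setT (V t).
Proof. exact: (measurable_shiryaev_roberts _ df0 dfC dfB (@mX t)). Qed.

Let mal t : measurable_fun setT (al t).
Proof. exact: (measurable_alive _ _ df0 dfC dfB (@mX t)). Qed.

Let ma t : measurable_fun setT (a t).
Proof. exact: measurable_indicator. Qed.

(** This is the drift inequality integrated over tau > t, an event of the past; independence of
    [X t.+1] replaces conditional expectation. *)
Lemma expectation_shiryaev_roberts_step t :
  \int[P]_w (V t.+1 w * a t w) <= \int[P]_w a t w + \int[P]_w (V t w * a t w).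
Proof.
pose Ft : set (set Omega) := \bigcup_(i in [set i | (1 <= i <= t)%N])
  preimage_set_system setT (X i) measurable.
have idF : @measurable_fun _ _ Omega (g_sigma_algebraType Ft) setT id.
  by move=> _ B FB; rewrite setTI; exact: natural_filtration_measurable FB.
(* The identity into the coarser sigma-algebra plays the role of the whole past as a single random
   variable. *)
pose Y : {mfun Omega >-> g_sigma_algebraType Ft} :=
  HB.pack (id : Omega -> g_sigma_algebraType Ft) (isMeasurableFun.Build _ _ _ _ _ idF).
have mXF i : (1 <= i <= t)%N ->
    @measurable_fun _ _ (g_sigma_algebraType Ft) E setT (X i).
  exact: natural_filtration_measurable_fun.
pose g (w : g_sigma_algebraType Ft) := a t w * (1 + V t w).
pose r y := (fB y)%:E / (density_at f0 fC pre t.+1 y)%:E.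
have df := is_density_at pre df0 dfC t.+1.
have mg : measurable_fun setT g.
  apply: emeasurable_funM.
    apply: (@measurable_indicator _ (g_sigma_algebraType Ft)).
    exact: (measurable_alive _ _ df0 dfC dfB mXF).
  apply: emeasurable_funD => //.
  exact: (measurable_shiryaev_roberts _ df0 dfC dfB mXF).
have g0 w : 0 <= g w by rewrite mule_ge0// adde_ge0.
have ind : forall A B, measurable A -> measurable B ->
    P (Y @^-1` A `&` X t.+1 @^-1` B) = P (Y @^-1` A) * P (X t.+1 @^-1` B).
  by move=> A B FA mB; exact: natural_filtration_indep law.1 FA mB.
have -> : \int[P]_w (V t.+1 w * a t w) = \int[P]_w (g (Y w) * r (X t.+1 w)).
  by apply: eq_integral => w _; rewrite muleC muleA.
rewrite (ge0_integral_indepM ind mg g0 (measurable_ratio dfB df) (ratio_ge0 dfB df)).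
have r1 : \int[distribution P (X t.+1)]_z r z <= 1.
  by apply: (integral_ratio_le1 dfB df) => A mA; exact: law.2.
apply: (@le_trans _ _ (\int[P]_w g (Y w))).
  by rewrite -[leRHS]mule1 lee_wpmul2l// integral_ge0.
rewrite -ge0_integralD//; last 2 first.
  by move=> w _; exact: mule_ge0.
  exact: emeasurable_funM.
rewrite le_eqVlt; apply/orP; left; apply/eqP; apply: eq_integral => w _.
by rewrite /g ge0_muleDr// mule1 [X in _ + X]muleC.
Qed.

(** The indicator of tau = t + 1. *)
Let stop_at t w : \bar R := (al t w && stops f0 fC fB b pre (X^~ w) t.+1)%:R%:E.

Let mstop t : measurable_fun setT (stop_at t).
Proof.
have ms t' : measurable_fun setT (fun w => stops f0 fC fB b pre (X^~ w) t').
  apply: measurable_and.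
    apply: measurable_fun_lee => //.
    exact: (measurable_cusumW _ df0 dfB (@mX t')).
  apply: measurable_or => //; apply: measurable_fun_lee => //.
  exact: (measurable_cusumSL _ df0 dfC dfB (@mX t')).
exact/measurable_indicator/measurable_and.
Qed.

Let p t : R := fine (\int[P]_w a t w).

Let pE t : \int[P]_w a t w = (p t)%:E.
Proof.
rewrite fineK// ge0_fin_numE ?integral_ge0//.
apply: (@le_lt_trans _ _ (\int[P]_w cst 1 w)).
  by apply: ge0_le_integral => // w _; rewrite lee_fin lern1 leq_b1.
by rewrite integral_cst//= mul1e probability_setT ltry.
Qed.

Let stop_at_ge0 t w : 0 <= stop_at t w. Proof. by rewrite lee_fin. Qed.

Let integral_alive_split t :
  \int[P]_w a t w = \int[P]_w a t.+1 w + \int[P]_w stop_at t w.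
Proof.
rewrite -ge0_integralD//; apply: eq_integral => w _.
by rewrite /a /stop_at /al/= -EFinD; case: alive; case: stops; rewrite /= ?addr0 ?add0r.
Qed.

(** The event tau > t splits into tau > t + 1 and tau = t + 1; on the latter V is at least
    [expR b]. *)
Lemma expectation_shiryaev_roberts_stop t :
  \int[P]_w (V t.+1 w * a t.+1 w) + (expR b)%:E * \int[P]_w stop_at t w <=
  \int[P]_w a t w + \int[P]_w (V t w * a t w).
Proof.
apply: le_trans (expectation_shiryaev_roberts_step t).
rewrite -ge0_integralZl ?lee_fin ?expR_ge0//.
rewrite -ge0_integralD//; last 4 first.
- by move=> w _; exact: mule_ge0.
- exact: emeasurable_funM.
- by move=> w _; rewrite mule_ge0// lee_fin expR_ge0.
- exact: measurable_funeM.
apply: ge0_le_integral => //.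
- move=> w _; rewrite adde_ge0//; first exact: mule_ge0.
  by rewrite mule_ge0// lee_fin expR_ge0.
- by apply: emeasurable_funD; [exact: emeasurable_funM|exact: measurable_funeM].
- exact: emeasurable_funM.
move=> w _; rewrite /a /stop_at.
have : al t w -> stops f0 fC fB b pre (X^~ w) t.+1 -> (expR b)%:E <= V t.+1 w.
  case: df0 dfC dfB => _ ? _ [_ ? _] [_ ? _]; exact: stops_shiryaev_roberts_ge.
rewrite /al/=; case: alive => /=; last by rewrite !mule0 adde0.
case: stops => /=; last by rewrite !mule0 adde0.
by move=> /(_ isT isT); rewrite mule0 !mule1 add0e.
Qed.

(** With [p t] = P(tau > t), this is expR b * P(tau <= n) <= E[min(tau, n)], rearranged. *)
Lemma expR_le_alive n : (expR b <= expR b * p n + \sum_(t < n) p t)%R.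
Proof.
(* The induction must carry E[V_n; tau > n], together with its finiteness. *)
suff [v v0 [_ le_v]] : exists2 v : R, (0 <= v)%R &
    \int[P]_w (V n w * a n w) = v%:E /\
    (expR b + v <= expR b * p n + \sum_(t < n) p t)%R.
  by apply: le_trans le_v; rewrite lerDl.
elim: n => [|n [v v0 [vE le_v]]].
  exists 0%R => //; split.
    by under eq_integral do rewrite mul0e; rewrite integral0.
  suff -> : p 0%N = 1%R by rewrite big_ord0 !addr0 mulr1.
  apply: EFin_inj; rewrite -pE.
  transitivity (\int[P]_w cst 1 w); first exact: eq_integral.
  by rewrite integral_cst//= mul1e probability_setT.
have := expectation_shiryaev_roberts_stop n.
have := integral_alive_split n; rewrite vE !pE.
have : 0 <= \int[P]_w stop_at n w by exact: integral_ge0.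
have : 0 <= \int[P]_w (V n.+1 w * a n.+1 w).
  by apply: integral_ge0 => w _; exact: mule_ge0.
case: (\int[P]_w stop_at n w) => [s| |]//.
case: (\int[P]_w (V n.+1 w * a n.+1 w)) => [v'| |]//.
rewrite -EFinM -!EFinD !lee_fin => v'0 s0 [ps] le_v'.
exists v' => //; split=> //.
(* Here [s] = P(tau = n + 1) and [p n = p n.+1 + s]; the term [expR b * s] turns [p n] into [p n.+1]
   in the bound. *)
rewrite big_ord_recr/=; move: le_v; rewrite ps mulrDr; move: le_v'; rewrite ps.
lra.
Qed.

(** If the expectation were some [r < expR b], then P(tau > n) would stay above a positive constant,
    while being at most r / n. *)
Lemma le_expectation_scusum_time :
  (expR b)%:E <= \int[P]_w scusum_time f0 fC fB b b (X^~ w).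
Proof.
set e := (X in _ <= X).
have sum_le n : (\sum_(t < n) p t)%:E <= e.
  rewrite -sumEFin; under eq_bigr do rewrite -pE.
  rewrite -ge0_integral_sum//.
  apply: ge0_le_integral => //.
  - by move=> w _; exact: sume_ge0.
  - exact: emeasurable_sum.
  - exact/(measurable_stopping_time (scusum_time_stopping_time b df0 dfC dfB X)).
  by move=> w _; exact: sum_alive_le_scusum_time.
have p_anti s t : (s <= t)%N -> (p t <= p s)%R.
  move=> st; rewrite -lee_fin -!pE; apply: ge0_le_integral => // w _.
  rewrite lee_fin ler_nat /al.
  by case: (boolP (alive _ _ _ _ _ _ t)) => // /(alive_le st) ->.
have : 0 <= e by have := sum_le 0%N; rewrite big_ord0.
case: e sum_le => [r| |]//; last by move=> *; rewrite leey.
move=> sum_le; rewrite !lee_fin => r0; rewrite leNgt; apply/negP => r_lt.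
(* [P(tau > n)] is nonincreasing in [n], so it is at most [e / n]. *)
have np n : (n%:R * p n <= r)%R.
  rewrite -lee_fin; apply: le_trans (sum_le n); rewrite lee_fin.
  rewrite mulr_natl -[X in (_ *+ X)%R](card_ord n) -sumr_const.
  by apply: ler_sum => i _; apply: p_anti; exact: ltnW.
(* Chosen so that n (c - r) > c r, against n (c - r) <= c n p(n) <= c r. *)
pose c := expR b; pose n := Num.bound (c * r / (c - r)).
have cr : (0 < c - r)%R by rewrite subr_gt0.
have c0 : (0 < c)%R by exact: expR_gt0.
have : (c * r / (c - r) < n%:R)%R.
  by apply: archi_boundP; rewrite divr_ge0 ?mulr_ge0// ltW.
rewrite ltr_pdivrMr// ltNge => /negP; apply.
have := sum_le n; rewrite lee_fin => sum_n.
have cn : (c - r <= c * p n)%R.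
  by have := expR_le_alive n; rewrite -/c; lra.
apply: (@le_trans _ _ (n%:R * (c * p n))%R); first by rewrite ler_wpM2l.
by rewrite mulrCA ler_wpM2l// ltW.
Qed.

End expectation.

(** * The bound at threshold [ln gamma] and the conclusion *)

Lemma scusum_time_ge1 (R : realType) (E : Type) (f0 fC fB : E -> R) (b : R)
  (x : nat -> E) : (1 <= scusum_time f0 fC fB b b x)%E.
Proof. by apply: le_ereal_inf_tmp => _ [n [n1 _ _] <-]; rewrite lee_fin ler1n. Qed.

Lemma le_expectation_scusum_time_ln (R : realType) (d dE : measure_display)
    (Omega : measurableType d) (E : measurableType dE)
    (mu : {measure set E -> \bar R}) (f0 fC fB : E -> R) (pre : pred nat)
    (X : nat -> {mfun Omega >-> E}) (P : probability Omega R) (gamma : R) :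
  is_density mu f0 -> is_density mu fC -> is_density mu fB ->
  independent_with_densities mu X P (density_at f0 fC pre) ->
  (forall t, pre t.+1 -> pre t) -> 1 <= gamma ->
  (gamma%:E <= \int[P]_w scusum_time f0 fC fB (ln gamma) (ln gamma) (X^~ w))%E.
Proof.
(* For [gamma = 1] the thresholds are 0 and V need not reach [gamma], but T >= 1. *)
move=> df0 dfC dfB law pre_down; rewrite le_eqVlt => /predU1P[<-|gamma1].
  rewrite -[leLHS](@probability_setT _ _ _ P) -[leLHS]mul1e -integral_cst//.
  apply: ge0_le_integral => //; last by move=> w _; exact: scusum_time_ge1.
  exact: measurable_stopping_time (scusum_time_stopping_time _ df0 dfC dfB X).
have := le_expectation_scusum_time df0 dfC dfB law (ln_gt0 gamma1) pre_down.
by rewrite lnK// posrE (lt_trans _ gamma1).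
Qed.

Unset Implicit Arguments.
Set Strict Implicit.

Theorem theorem2 (R : realType) (d dE : measure_display)
  (Omega : measurableType d) (E : measurableType dE)
  (mu : {measure set E -> \bar R}) (f0 fC fB : E -> R)
  (hf0 : is_density mu f0) (hfC : is_density mu fC) (hfB : is_density mu fB)
  (h0C : ~ (f0 = fC %[ae mu])) (h0B : ~ (f0 = fB %[ae mu]))
  (hCB : ~ (fC = fB %[ae mu]))
  (X : nat -> {mfun Omega >-> E})
  (Pinf : probability Omega R) (PC : nat -> probability Omega R)
  (hPinf : no_change_law mu X f0 Pinf)
  (hPC : forall nu : nat, (1 <= nu)%N -> change_point_law mu X f0 fC nu (PC nu))
  (gamma : R) (hgamma : 1 <= gamma) :
  false_alarm_class X Pinf PC gamma
    (fun w => scusum_time f0 fC fB (ln gamma) (ln gamma) (fun t => X t w)).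
Proof.
split; first exact: (scusum_time_stopping_time _ hf0 hfC hfB X).
  exact: (@le_expectation_scusum_time_ln _ _ _ _ _ mu _ _ _ xpredT).
apply: le_ereal_inf_tmp => _ [nu nu1 <-].
(* The bound does not depend on [nu], so it passes to the infimum. *)
apply: (@le_expectation_scusum_time_ln _ _ _ _ _ mu _ _ _ (fun t => t < nu)%N) => //.
  exact: hPC.
by move=> t; exact: ltnW.
Qed.
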